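(* Let $\alpha,\beta>0$ and let $\lambda\in\mathbb{R}$, $a,b>0$ with $-b<\frac{\lambda}{2}<b$. Let $X,Y$ be independent random variables with $X\sim \mathrm{K}(\lambda,a,b;\alpha,1)$ and $Y\sim\mathrm{K}(-\lambda,a,b;\beta,1)$, and set $(U,V)=H_{II}^{+,\alpha,\beta}(X,Y)$. Then $U$ and $V$ are independent, with $U\sim\mathrm{K}(-\lambda,a,b;\alpha,1)$ and $V\sim \mathrm{K}(\lambda,a,b;\beta,1)$.
   Context: $\mathbb{R}_+=(0,\infty)$. For $\alpha,\beta>0$ the map $H_{II}^{+,\alpha,\beta}:\mathbb{R}_+^2\to\mathbb{R}_+^2$ is $$H_{II}^{+,\alpha,\beta}(x,y)=\left(\frac{y}{\alpha}\,\frac{\beta+\alpha x+\beta y}{1+x+y},\ \frac{x}{\beta}\,\frac{\alpha+\alpha x+\beta y}{1+x+y}\right).$$ For $p,q>0$, $a>0$ and $\lambda,b\in\mathbb{R}$ with $-b<\frac{\lambda}{2}$, the Kummer distribution of type 2 $\mathrm{K}(\lambda,a,b;p,q)$ is the probability distribution on $\mathbb{R}_+$ with density proportional to $x^{\lambda-1}e^{-apx}(1+qx^{-1})^{-b+\frac{\lambda}{2}}$, $x\in\mathbb{R}_+$. *)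

(* Defs.v *)
From HB Require Import structures.
From mathcomp Require Import all_boot all_order all_algebra.
From mathcomp Require Import all_classical all_reals all_analysis.
Set Implicit Arguments. Unset Strict Implicit. Unset Printing Implicit Defensive.
Import Order.TTheory GRing.Theory Num.Theory.
Local Open Scope classical_set_scope.
Local Open Scope ring_scope.

(* The map H_II^{+,alpha,beta} on R_+^2 (the same formula, as a total map). *)
Definition H_II {R : realType} (alpha beta : R) (x y : R) : R * R :=
  (y / alpha * ((beta + alpha * x + beta * y) / (1 + x + y)),
   x / beta * ((alpha + alpha * x + beta * y) / (1 + x + y))).

Definition kummer_dens {R : realType} (lam a b p q : R) (x : R) : R :=
  if 0 < x then
    x `^ (lam - 1) * expR (- (a * p * x)) * (1 + q / x) `^ (- b + lam / 2)
  else 0.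

Definition has_kummer_law {d : measure_display} {T : measurableType d}
  {R : realType} (P : probability T R) (X : T -> R) (lam a b p q : R) : Prop :=
  exists c : R, 0 < c /\
    forall A : set R, measurable A ->
      P (X @^-1` A) =
        (c%:E * \int[lebesgue_measure]_(x in A) (kummer_dens lam a b p q x)%:E)%E.

Definition indep_rv {d : measure_display} {T : measurableType d}
  {R : realType} (P : probability T R) (X Y : T -> R) : Prop :=
  forall A B : set R, measurable A -> measurable B ->
    P (X @^-1` A `&` Y @^-1` B) = (P (X @^-1` A) * P (Y @^-1` B))%E.

(* Main.v *)
(** Put S = 1 + x + y, D = alpha + alpha x + beta y, E = beta + alpha x + beta y.
    The map (u, v) = H_II x y satisfies u = y E / (alpha S),
    1 + u = (1 + y) D / (alpha S), v = x D / (beta S) and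
    1 + v = (1 + x) E / (beta S), and it preserves s = alpha x + beta y =
    alpha u + beta v. On a level line of s, where D and E are constant, it is the
    Moebius map y |-> u = y E / (D + (alpha - beta) y), with derivative
    E D / (alpha S)^2. Hence the joint density of (X, Y) is transported to a
    constant multiple of the product of the two target densities by
    one-dimensional changes of variables only: two shears (x, y) -> (s, y) and
    (u, v) -> (s, u), and the Moebius map for fixed s. *)

Require Import Defs.
From HB Require Import structures.
From mathcomp Require Import all_boot all_order all_algebra.
From mathcomp Require Import all_classical all_reals all_analysis.
From mathcomp Require Import measurable_realfun ring lra.
Set Implicit Arguments.
Unset Strict Implicit.
Unset Printing Implicit Defensive.
Import Order.TTheory GRing.Theory Num.Theory.
Import numFieldNormedType.Exports.
Local Open Scope classical_set_scope.
Local Open Scope ring_scope.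

(** * Measures given by a density *)

Section density.
Local Open Scope ereal_scope.
Context d (T : measurableType d) (R : realType).
Variable mu : {measure set T -> \bar R}.

(** The proofs [mg] and [g0] are arguments so that the measure structure declared below can be
    inferred from the term itself. *)
Definition mdensity (g : T -> R) (mg : measurable_fun [set: T] g)
    (g0 : forall x, (0 <= g x)%R) (A : set T) : \bar R :=
  \int[mu]_(x in A) (g x)%:E.

Variables (g : T -> R) (mg : measurable_fun [set: T] g).
Variable g0 : forall x, (0 <= g x)%R.

Let mdensity0 : mdensity mg g0 set0 = 0.
Proof. exact: integral_set0. Qed.

Let mdensity_ge0 A : 0 <= mdensity mg g0 A.
Proof. by apply: integral_ge0 => x _; rewrite lee_fin. Qed.

Let mdensity_sigma_additive : semi_sigma_additive (mdensity mg g0).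
Proof.
move=> F mF tF mUF; rewrite /mdensity; apply: cvg_toP.
  apply: ereal_nondecreasing_is_cvgn => m n mn.
  apply: lee_sum_nneg_natr => // k _ _; apply: integral_ge0 => x _.
  by rewrite lee_fin.
rewrite ge0_integral_bigcup//.
- by apply/measurable_EFinP; exact: measurable_funTS.
- by move=> x _; rewrite lee_fin.
Qed.

HB.instance Definition _ := isMeasure.Build _ _ _ (mdensity mg g0)
  mdensity0 mdensity_ge0 mdensity_sigma_additive.

Import HBNNSimple.

(** Standard extension from sets to functions: the hypothesis is the case of indicators, linearity
    gives simple functions, and monotone convergence along [nnsfun_approx] gives nonnegative
    measurable [f]. *)
Lemma ge0_integral_density (nu : {measure set T -> \bar R}) (f : T -> \bar R) :
  (forall A, measurable A -> nu A = \int[mu]_(x in A) (g x)%:E) ->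
  measurable_fun [set: T] f -> (forall x, 0 <= f x) ->
  \int[nu]_x f x = \int[mu]_x (f x * (g x)%:E).
Proof.
move=> nuE mf f0; pose h := nnsfun_approx measurableT mf.
have mgE : measurable_fun [set: T] (EFin \o g) by exact/measurable_EFinP.
have -> : \int[nu]_x f x = limn (fun n => \int[nu]_x (EFin \o h n) x).
  rewrite -monotone_convergence//.
  - apply: eq_integral => x _; apply/esym/cvg_lim => //.
    exact: cvg_nnsfun_approx.
  - by move=> n; exact/measurable_EFinP.
  - by move=> n x _; rewrite lee_fin.
  - by move=> x _ m n mn; rewrite lee_fin; exact/lefP/nd_nnsfun_approx.
have -> : \int[mu]_x (f x * (g x)%:E) =
    limn (fun n => \int[mu]_x ((EFin \o h n) x * (g x)%:E)).
  rewrite -monotone_convergence//.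
  - apply: eq_integral => x _; apply/esym/cvg_lim => //.
    by apply: cvgeZr => //; exact: cvg_nnsfun_approx.
  - by move=> n; apply: emeasurable_funM => //; exact/measurable_EFinP.
  - by move=> n x _; rewrite mule_ge0// lee_fin.
  - move=> x _ m n mn; rewrite lee_wpmul2r// ?lee_fin//.
    exact/lefP/nd_nnsfun_approx.
congr (limn _); apply/funext => n.
have mh r : measurable (h n @^-1` [set r]) by exact: measurable_sfunP.
transitivity (\int[nu]_x
   (\sum_(y \in range (h n)) (y * \1_(h n @^-1` [set y]) x)%:E)).
  by apply: eq_integral => t _; rewrite /= fimfunE -fsumEFin.
have indich r : measurable_fun [set: T] (fun x => (r * \1_(h n @^-1` [set r]) x)%:E).
  by apply/measurable_EFinP; exact: measurable_funM.
rewrite ge0_integral_fsum//; last by move=> m y _; exact: nnfun_muleindic_ge0.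
transitivity (\int[mu]_x (\sum_(y \in range (h n))
    (y * \1_(h n @^-1` [set y]) x)%:E * (g x)%:E)); last first.
  apply: eq_integral => x _.
  rewrite -ge0_mule_fsuml => [|y]; last exact: nnfun_muleindic_ge0.
  by rewrite fsumEFin // -(fimfunE _ x).
rewrite ge0_integral_fsum//; last 2 first.
  - by move=> y; apply: emeasurable_funM.
  - by move=> m y _; apply: mule_ge0; [exact: nnfun_muleindic_ge0|rewrite lee_fin].
apply: eq_fsbigr => r; rewrite inE => -[t _ <-].
under eq_integral do rewrite EFinM.
rewrite integralZl_indic_nnsfun// integral_indic// setIT nuE//.
under [RHS]eq_integral do rewrite EFinM -muleA.
rewrite ge0_integralZl//.
- congr (_ * _); rewrite integral_mkcond; apply: eq_integral => x _.
  by rewrite epatch_indic muleC.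
- by apply: emeasurable_funM => //; exact/measurable_EFinP.
- by move=> x _; rewrite mule_ge0 ?lee_fin.
- by rewrite lee_fin.
Qed.

End density.

(** * Changes of variables on the real line *)

Section lebesgue_change_of_variables.
Local Open Scope ereal_scope.
Context {R : realType}.
Local Notation mu := (@lebesgue_measure R).

(** The measure [r] times the image of [mu] under [phi] gives every half-open interval its length,
    so it is Lebesgue measure by uniqueness. Integrating [h] against it yields the formula. *)
Lemma ge0_integral_affine (r t : R) (h : R -> \bar R) : (0 < r)%R ->
  measurable_fun [set: R] h -> (forall x, 0 <= h x) ->
  \int[mu]_x h x = \int[mu]_x (r%:E * h (r * x + t)%R).
Proof.
move=> r0 mh h0; pose phi := fun x : measurableTypeR R => (r * x + t)%R : measurableTypeR R.
have mphi : measurable_fun setT phi.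
  by apply: measurable_funD => //; exact: measurable_funM.
pose nu_ : {measure set (measurableTypeR R) -> \bar R} :=
  mscale (NngNum (ltW r0)) (pushforward mu phi).
pose nu := nu_ mphi.
have muE A : measurable A -> mu A = nu A.
  apply: lebesgue_measure_unique => _ [[a b] _ <-] /=.
  rewrite /mscale/= /pushforward/=.
  rewrite (_ : phi @^-1` _ = `](a - t) / r, (b - t) / r]%classic)%R; last first.
    apply/seteqP; split => x /=; rewrite /phi !in_itv/=.
      by rewrite ltr_pdivrMr// ler_pdivlMr// ltrBlDr lerBrDr (mulrC x).
    by rewrite ltr_pdivrMr// ler_pdivlMr// ltrBlDr lerBrDr (mulrC x).
  rewrite !lebesgue_measure_itv/= !lte_fin ltr_pM2r ?invr_gt0// ltrD2r.
  case: ifP => _; last by rewrite mule0.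
  rewrite -!EFinB -EFinM; congr EFin; field; exact: lt0r_neq0.
rewrite (eq_measure_integral nu); last by move=> A mA _; exact: muE.
rewrite ge0_integral_mscale//= ge0_integral_pushforward//= preimage_setT.
rewrite ge0_integralZl//; first exact: measurableT_comp mh mphi.
by rewrite lee_fin ltW.
Qed.

(** Lebesgue measure restricted to []F a, F b[] is the image under [F] of the measure with density
    [f] on []a, b[]. The two are compared on open rays, where the claim is the fundamental theorem
    of calculus, and then [h] is integrated against both. *)
Lemma ge0_integral_substitution_oo (F f : R -> R) (a b : R) (h : R -> \bar R) :
  (a < b)%R -> {in `[a, b]%R, forall x, is_derive x (1%R : R) F (f x)} ->
  {in `[a, b]%R, continuous f} -> {in `[a, b]%R, forall x, 0 < f x}%R ->
  measurable_fun [set: R] F -> measurable_fun [set: R] f ->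
  measurable_fun [set: R] h -> (forall x, 0 <= h x) ->
  \int[mu]_(x in `]F a, F b[) h x = \int[mu]_(x in `]a, b[) (h (F x) * (f x)%:E).
Proof.
move=> ab dF cf f0 mF mf mh h0.
have cF : {in `[a, b]%R, continuous F}.
  by move=> x /dF dFx; apply/differentiable_continuous/derivable1_diffP.
have wcF x y : (a <= x)%R -> (y <= b)%R -> {within `[x, y], continuous F}.
  move=> ax yb; apply: continuous_in_subspaceT => z; rewrite inE/= in_itv/=.
  move=> /andP[xz zy]; apply: cF; rewrite in_itv/=.
  by rewrite (le_trans ax xz) (le_trans zy yb).
have ltF : {in `[a, b]%R &, {homo F : x y / (x < y)%R}}.
  apply: gtr0_derive1_lt_cc; last exact: wcF.
    by move=> x /subset_itv_oo_cc /dF dFx.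
  by move=> x /subset_itv_oo_cc /[dup] /f0 + /dF dFx; rewrite derive1E derive_val.
have lebF := le_mono_in ltF.
have ltbF := leW_mono_in lebF.
have aab : a \in `[a, b]%R by rewrite in_itv/= lexx ltW.
have bab : b \in `[a, b]%R by rewrite in_itv/= lexx ltW.
have FTC x : (a <= x < b)%R -> \int[mu]_(y in `]x, b[) (f y)%:E = (F b - F x)%:E.
  move=> /andP[ax xb]; rewrite -(@integral_itv_bndoo _ _ _ _ true false); last first.
    by apply: measurable_funTS; exact/measurable_EFinP.
  rewrite (@continuous_FTC2 _ f F)// ?EFinB//.
  - apply: continuous_in_subspaceT => z; rewrite inE/= in_itv/= => /andP[xz zb].
    by apply: cf; rewrite in_itv/= (le_trans ax).
  - split => [z|  |].
    + rewrite in_itv/= => /andP[xz zb].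
      have /dF dFz : z \in `[a, b]%R.
        by rewrite in_itv/= ltW// ?(le_lt_trans ax)//= ltW.
      exact: ex_derive.
    + by apply: cvg_at_right_filter; apply: cF; rewrite in_itv/= ax ltW.
    + by apply: cvg_at_left_filter; apply: cF; rewrite in_itv/= lexx ltW.
  - move=> z; rewrite in_itv/= => /andP[xz zb].
    have /dF dFz : z \in `[a, b]%R.
      by rewrite in_itv/= ltW// ?(le_lt_trans ax)//= ltW.
    by rewrite derive1E derive_val.
pose g := f \_ `]a, b[.
have mg : measurable_fun [set: R] g.
  by apply/measurable_restrict => //; rewrite setTI; exact: measurable_funTS.
have g0 x : (0 <= g x)%R.
  rewrite /g patchE; case: ifPn => // /[!inE] /= xab.
  by rewrite ltW// f0//; exact: subset_itv_oo_cc xab.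
pose F' : measurableTypeR R -> measurableTypeR R := F.
have mF' : measurable_fun setT F' by exact: mF.
pose nu_ : {measure set (measurableTypeR R) -> \bar R} :=
  pushforward (mdensity mu mg g0) F'.
pose nu := nu_ mF'.
have mJ : measurable (`]F a, F b[%classic : set (measurableTypeR R)) by [].
pose muJ : {measure set (measurableTypeR R) -> \bar R} := mrestr mu mJ.
(* Uniqueness on a generating family stable under intersection: the rays []c, +oo[]. The rays
   starting at [- n] exhaust the line and have finite [muJ] measure. *)
have nuE A : measurable A -> muJ A = nu A.
  move=> mA; refine (@measure_unique _ R (measurableTypeR R) (@RGenOInfty.G R)
      (fun n : nat => `](- n%:R : R)%R, +oo[%classic) _ _ _ _ muJ nu _ _ A mA).
  - exact: RGenOInfty.measurableE.
  - move=> _ _ [x ->] [y ->]; exists (Num.max x y).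
    by apply/seteqP; split=> z /=; rewrite !in_itv/= !andbT gt_max => /andP.
  - by move=> n; exists (- n%:R)%R.
  - apply/seteqP; split => // x _; exists (Num.truncn `|x|).+1 => //=.
    rewrite in_itv/= andbT ltrNl (le_lt_trans (ler_norm _))// normrN.
    exact: truncnS_gt.
  (* Clamping [c] to [[F a, F b]] changes neither measure of the ray, and gives the intermediate
     value theorem a preimage [x0] of the clamped value. *)
  - move=> _ [c ->]; pose c' := Num.max (F a) (Num.min c (F b)).
    have FaFb : (F a < F b)%R by rewrite ltF.
    have [x0 x0ab Fx0] : exists2 x, x \in `[a, b]%R & F x = c'.
      apply: IVT; [exact: ltW|exact: wcF|].
      rewrite min_l ?max_r ?(ltW FaFb)// /c' le_max lexx/= ge_max (ltW FaFb)/=.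
      by rewrite ge_min lexx orbT.
    have -> : nu `]c, +oo[%classic = \int[mu]_(x in `]x0, b[) (f x)%:E.
      rewrite /nu/= /pushforward/= /mdensity.
      transitivity (\int[mu]_(x in F @^-1` `]c, +oo[) ((EFin \o f) \_ `]a, b[) x).
        by apply: eq_integral => x _; rewrite restrict_EFin.
      rewrite -integral_mkcondr; congr integral.
      apply/seteqP; split => x /=; rewrite !in_itv/= ?andbT.
        move=> [cFx /andP[ax xb]].
        have xab : x \in `[a, b]%R by rewrite in_itv/= !ltW.
        by rewrite xb andbT -ltbF// Fx0 /c' gt_max ltF//= gt_min cFx.
      move=> /andP[x0x xb].
      have ax : (a < x)%R by apply: le_lt_trans x0x; move: x0ab; rewrite in_itv => /andP[].
      have xab : x \in `[a, b]%R by rewrite in_itv/= !ltW.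
      rewrite ax xb; split => //.
      move: x0x; rewrite -ltbF// Fx0 /c' gt_max gt_min => /andP[_ /orP[//|]].
      by rewrite ltNge ltW// ltF.
    rewrite /muJ/= /mrestr (_ : _ `&` _ = `]c', F b[%classic); last first.
      apply/seteqP; split => x /=; rewrite !in_itv/= ?andbT.
        move=> [cx /andP[ax xb]].
        by rewrite xb /c' gt_max ax gt_min cx.
      rewrite /c' gt_max gt_min => /andP[/andP[ax cx] xb]; rewrite ax xb; split => //.
      by move: cx => /orP[//|]; rewrite ltNge ltW.
    rewrite lebesgue_measure_itv/= lte_fin -Fx0 ltbF//.
    (* If [x0] is not below [b], both sides are zero. *)
    case: ifPn => [x0b|bx0]; last by rewrite set_itv_ge ?integral_set0// bnd_simp.
    by rewrite FTC// x0b andbT; move: x0ab; rewrite in_itv => /andP[].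
  - move=> n; rewrite /muJ/= /mrestr (@le_lt_trans _ _ (mu `]F a, F b[))//.
      by apply: le_measure; rewrite ?inE//; exact: measurableI.
    by rewrite lebesgue_measure_itv/=; case: ifP => // _; rewrite -EFinB ltry.
transitivity (\int[muJ]_x h x).
  rewrite (@ge0_integral_density _ _ _ mu (\1_(`]F a, F b[)))//.
  - rewrite [LHS]integral_mkcond; apply: eq_integral => x _.
    by rewrite epatch_indic.
  - by move=> A mA; rewrite integral_indic// setIC.
rewrite (eq_measure_integral nu); last by move=> A mA _; exact: nuE.
rewrite ge0_integral_pushforward//= preimage_setT.
have mhF : measurable_fun setT (h \o F) by exact: measurableT_comp mh mF.
rewrite (@ge0_integral_density _ _ _ mu g)//.
rewrite [RHS]integral_mkcond; apply: eq_integral => x _ /=.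
rewrite /g !patchE; case: ifPn => // _; by rewrite mule0.
Qed.

End lebesgue_change_of_variables.

(** * Measurable quotients, joint laws and shears of the plane *)

(** The inverse is the power of exponent -1 on the positive half-line, and its odd reflection
    elsewhere; at 0 both conventions give 0. *)
Lemma measurable_invr (R : realType) : measurable_fun [set: R] (@GRing.inv R).
Proof.
rewrite (_ : @GRing.inv R =
  fun x => if 0 < x then x `^ (-1) else - ((- x) `^ (-1))); last first.
  apply/funext => x; case: ltP => x0; first by rewrite powR_inv1// ltW.
  by rewrite powR_inv1 ?oppr_ge0// invrN opprK.
apply: measurable_fun_ifT.
- exact: measurable_fun_ltr.
- exact: measurable_powR.
- have mN : measurable_fun [set: R] (-%R : R -> R) by exact: oppr_measurable.
  exact: (measurableT_comp mN (measurableT_comp (@measurable_powR R (-1)) mN)).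
Qed.

Lemma measurable_fun_div d (T : measurableType d) (R : realType)
    (f g : T -> R) :
  measurable_fun [set: T] f -> measurable_fun [set: T] g ->
  measurable_fun [set: T] (fun x => f x / g x).
Proof.
move=> mf mg; apply: measurable_funM => //.
exact: measurableT_comp (@measurable_invr R) mg.
Qed.

(** Independence says that the law of the pair agrees with the product of the marginal laws on
    rectangles, hence everywhere. The product measure is an iterated integral over sections, into
    which the two densities are inserted. *)
Lemma indep_rv_joint_law d (T : measurableType d) (R : realType)
    (P : probability T R) (X Y : T -> R) (f g : R -> R) (c c' : R) :
  measurable_fun [set: T] X -> measurable_fun [set: T] Y -> indep_rv P X Y ->
  measurable_fun [set: R] f -> measurable_fun [set: R] g ->
  (forall x, 0 <= f x) -> (forall x, 0 <= g x) -> 0 <= c -> 0 <= c' ->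
  (forall A, measurable A ->
     P (X @^-1` A) = c%:E * \int[lebesgue_measure]_(x in A) (f x)%:E)%E ->
  (forall A, measurable A ->
     P (Y @^-1` A) = c'%:E * \int[lebesgue_measure]_(x in A) (g x)%:E)%E ->
  forall M : set (R * R), measurable M ->
  (P ((fun t => (X t, Y t)) @^-1` M) = (c * c')%:E *
    \int[lebesgue_measure]_x \int[lebesgue_measure]_y
      (\1_M (x, y) * (f x * g y))%:E)%E.
Proof.
move=> mX mY indXY mf mg f0 g0 c0 c'0 hX hY M mM.
pose L := measurableTypeR R.
have mX' : measurable_fun setT (X : T -> L) by exact: mX.
have mY' : measurable_fun setT (Y : T -> L) by exact: mY.
have mM' : measurable (M : set (L * L)) by exact: mM.
pose X' : {mfun T >-> L} := HB.pack X (isMeasurableFun.Build _ _ _ _ _ mX').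
pose Y' : {mfun T >-> L} := HB.pack Y (isMeasurableFun.Build _ _ _ _ _ mY').
pose Z : T -> L * L := fun t => (X t, Y t).
have mZ : measurable_fun setT Z by exact: measurable_fun_pair.
pose m_ : {measure set (L * L) -> \bar R} := pushforward P Z.
rewrite -[LHS]/(m_ mZ M) -(@product_measure_unique _ _ _ _ _
  (distribution P X') (distribution P Y'))//.
rewrite /product_measure1.
have mcf : measurable_fun [set: R] (fun x => c * f x) by exact: measurable_funM.
have cf0 x : 0 <= c * f x by rewrite mulr_ge0.
have hX' (A : set L) : measurable A -> distribution P X' A =
    (\int[lebesgue_measure]_(x in A) (c * f x)%:E)%E.
  move=> mA; rewrite -[LHS]/(P (X @^-1` A)) hX//.
  under [RHS]eq_integral do rewrite EFinM.
  rewrite ge0_integralZl//.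
  - by apply: measurable_funTS; exact/measurable_EFinP.
  - by move=> x _; rewrite lee_fin.
(* The outer integral, against the law of [X], becomes a Lebesgue integral; the inner one is the
   [Y]-measure of a section of [M]. *)
rewrite (@ge0_integral_density _ _ _ lebesgue_measure _ mcf cf0 _ _ hX'
  (measurable_fun_xsection (distribution P Y') mM'))//.
have mMfg : measurable_fun setT (fun z : L * L => (\1_M z * (f z.1 * g z.2))%:E).
  apply/measurable_EFinP; apply: measurable_funM => //; apply: measurable_funM.
  - exact: measurableT_comp mf measurable_fst.
  - exact: measurableT_comp mg measurable_snd.
have Mfg0 z : (0 <= (\1_M z * (f z.1 * g z.2))%:E)%E.
  by rewrite lee_fin !mulr_ge0.
rewrite -ge0_integralZl//; last 3 first.
- exact: (measurable_fun_fubini_tonelli_F _ mMfg).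
- by move=> x _; apply: integral_ge0 => y _; exact: (Mfg0 (x, y)).
- by rewrite lee_fin mulr_ge0.
apply: eq_integral => x _ /=.
rewrite [distribution _ _ _]hY//; last exact: measurable_xsection.
rewrite integral_mkcond.
under [in RHS]eq_integral => y _ do rewrite (mulrCA _ (f x)) EFinM.
rewrite [in RHS]ge0_integralZl//; last 3 first.
- apply/measurable_EFinP; apply: measurable_funM => //.
  have mM1 : measurable_fun setT (\1_M : L * L -> R) by exact: measurable_indic.
  exact: (measurable_fun_pair2 x mM1).
- by move=> y _; rewrite lee_fin mulr_ge0.
- by rewrite lee_fin.
rewrite [in LHS]muleAC [in RHS]muleA -!EFinM; congr (_%:E * _)%E.
  by rewrite mulrCA mulrA.
apply: eq_integral => y _; rewrite epatch_indic -EFinM mulrC; congr (_ * _)%:E.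
by rewrite !indicE mem_xsection.
Qed.

(** Tonelli brings the integral in [x] inside, the affine substitution [s = p x + q y] is made with
    [y] fixed, and Tonelli restores the order. The inner integral then runs along a level line of
    [s]. *)
Lemma integral_shear (R : realType) (p q : R) (k : R * R -> \bar R) :
  0 < p -> measurable_fun [set: R * R] k -> (forall z, 0 <= k z)%E ->
  (\int[lebesgue_measure]_x \int[lebesgue_measure]_y k (x, y) =
   \int[lebesgue_measure]_s \int[lebesgue_measure]_y
     (p^-1%:E * k (((s - q * y) / p)%R, y)))%E.
Proof.
move=> p0 mk k0; pose L := measurableTypeR R.
rewrite fubini_tonelli//.
have mk' : measurable_fun [set: L * L]
    (fun z : L * L => (p^-1%:E * k (((z.1 - q * z.2) / p)%R, z.2))%E).
  apply: measurable_funeM; apply: measurableT_comp mk _.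
  apply: measurable_fun_pair => //; apply: measurable_funM => //.
  by apply: measurable_funB => //; exact: measurable_funM.
have k'0 (z : L * L) : (0 <= p^-1%:E * k (((z.1 - q * z.2) / p)%R, z.2))%E.
  by rewrite mule_ge0// lee_fin invr_ge0 ltW.
apply: etrans; last exact/esym/(fubini_tonelli _ mk' k'0).
apply: eq_integral => y _.
rewrite (@ge0_integral_affine _ p^-1 (- (q * y / p)) (fun x => k (x, y)))//.
- by apply: eq_integral => x _ /=; do 2 f_equal; rewrite mulrBl (mulrC x).
- by rewrite invr_gt0.
- exact: measurable_fun_pair1.
Qed.

(** * Kummer densities and their behaviour under the map *)

Section kummer.
Context {R : realType}.
Implicit Types (alpha beta lam a b p s x y : R).

Lemma kummer_dens_ge0 lam a b p x : 0 <= kummer_dens lam a b p 1 x.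
Proof.
by rewrite /kummer_dens; case: ifP => // _; rewrite !mulr_ge0 ?powR_ge0 ?expR_ge0.
Qed.

Lemma measurable_kummer_dens lam a b p :
  measurable_fun [set: R] (kummer_dens lam a b p 1).
Proof.
apply: measurable_fun_ifT => //; first exact: measurable_fun_ltr.
apply: measurable_funM; first apply: measurable_funM.
- exact: measurable_powR.
- apply: measurableT_comp; first exact: measurable_expR.
  apply: measurableT_comp; first exact: oppr_measurable.
  exact: measurable_funM.
- apply: (measurableT_comp (measurable_powR _)).
  by apply: measurable_funD => //; exact: measurable_fun_div.
Qed.

(** With the density as a single exponential, identities between products of densities become
    identities linear in logarithms. *)
Lemma kummer_densE lam a b p x : 0 < x ->
  kummer_dens lam a b p 1 x = expR ((lam - 1) * ln x - a * p * x +
    (- b + lam / 2) * (ln (1 + x) - ln x)).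
Proof.
move=> x0; rewrite /kummer_dens x0 !expRD -{1}(lnK x0).
have x1 : 0 < 1 + x by rewrite addr_gt0.
rewrite (_ : 1 + 1 / x = (1 + x) / x); last by field; exact: lt0r_neq0.
rewrite lnK// -ln_div ?posrE//.
rewrite -(mulrC (ln x)) expRM ?lnK ?posrE// /powR.
by rewrite !gt_eqF// ?divr_gt0// (mulrC (ln x)).
Qed.

(** This matches the exponential factors of source and target densities, and recovers the second
    coordinate from the first on a level line. *)
Lemma H_II_conserved alpha beta x y : 0 < alpha -> 0 < beta -> 0 < x -> 0 < y ->
  alpha * (H_II alpha beta x y).1 + beta * (H_II alpha beta x y).2 =
  alpha * x + beta * y.
Proof.
move=> a0 b0 x0 y0; rewrite /H_II/=.
have S0 : 1 + x + y != 0 by apply: lt0r_neq0; lra.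
by field; rewrite S0 !lt0r_neq0.
Qed.

(** The pointwise form of the change of variables: [1 / alpha] and [1 / beta] come from the two
    shears, and the last factor is the derivative of the Moebius map. The factor
    [(beta / alpha)^lam], written as an exponential, absorbs the powers of [alpha] and [beta] left
    by [u] and [v]. *)
Lemma kummer_dens_H_II alpha beta lam a b x y :
  0 < alpha -> 0 < beta -> 0 < x -> 0 < y ->
  let u := (H_II alpha beta x y).1 in
  let v := (H_II alpha beta x y).2 in
  kummer_dens lam a b alpha 1 x * kummer_dens (- lam) a b beta 1 y / alpha =
  expR (lam * (ln beta - ln alpha)) / beta *
    (kummer_dens (- lam) a b alpha 1 u * kummer_dens lam a b beta 1 v) *
    ((beta + alpha * x + beta * y) * (alpha + alpha * x + beta * y) /
     (alpha * (1 + x + y)) ^+ 2).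
Proof.
move=> a0 b0 x0 y0 u v.
have := H_II_conserved a0 b0 x0 y0; rewrite -/u -/v => uv.
pose S := 1 + x + y; pose D := alpha + alpha * x + beta * y.
pose E := beta + alpha * x + beta * y.
have ax0 : 0 < alpha * x by exact: mulr_gt0.
have by0 : 0 < beta * y by exact: mulr_gt0.
have S0 : 0 < S by rewrite /S; lra.
have D0 : 0 < D by rewrite /D; lra.
have E0 : 0 < E by rewrite /E; lra.
have an : alpha != 0 by exact: lt0r_neq0.
have bn : beta != 0 by exact: lt0r_neq0.
have Sn : 1 + x + y != 0 by exact: lt0r_neq0.
have x1 : 0 < 1 + x by lra.
have y1 : 0 < 1 + y by lra.
have uE : u = y * E / (alpha * S).
  by rewrite /u /H_II/= /E /S; field; rewrite Sn.
have vE : v = x * D / (beta * S).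
  by rewrite /v /H_II/= /D /S; field; rewrite Sn.
have u1E : 1 + u = (1 + y) * D / (alpha * S).
  by rewrite uE /D /E /S; field; rewrite Sn.
have v1E : 1 + v = (1 + x) * E / (beta * S).
  by rewrite vE /D /E /S; field; rewrite Sn.
have u0 : 0 < u by rewrite uE divr_gt0// mulr_gt0.
have v0 : 0 < v by rewrite vE divr_gt0// mulr_gt0.
have lnM3 (p q r s : R) : 0 < p -> 0 < q -> 0 < r -> 0 < s ->
    ln (p * q / (r * s)) = ln p + ln q - (ln r + ln s).
  move=> p0 q0 r0 s0.
  by rewrite ln_div ?posrE ?mulr_gt0// !lnM ?posrE.
have JE : E * D / (alpha * S) ^+ 2 =
    expR (ln E + ln D - (2 * (ln alpha + ln S))).
  rewrite expRB expRD !lnK ?posrE//; congr (_ / _).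
  by rewrite expRM_natl expRD !lnK ?posrE.
have inv (r : R) : 0 < r -> r^-1 = expR (- ln r) by move=> r0; rewrite expRN lnK.
rewrite -/E -/D -/S JE !kummer_densE// (inv alpha)// (inv beta)//.
(* Only the occurrences of [u] and [v] under [ln] are expanded; the linear terms stay and are
   handled by the conserved sum. *)
rewrite u1E v1E {1 3}uE {1 3}vE !lnM3// -!expRD; congr expR.
have -> : a * alpha * u = a * (alpha * x + beta * y) - a * beta * v.
  by rewrite -uv; ring.
by field.
Qed.

(** * Change of variables along the level lines *)

Lemma kummer_dens_eq0 lam a b p x : x <= 0 -> kummer_dens lam a b p 1 x = 0.
Proof. by move=> x0; rewrite /kummer_dens ltNge x0. Qed.

Lemma measurable_H_II alpha beta :
  measurable_fun [set: R * R] (fun z : R * R => H_II alpha beta z.1 z.2).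
Proof.
have m1 : measurable_fun [set: R * R] (fst : R * R -> R) by exact: measurable_fst.
have m2 : measurable_fun [set: R * R] (snd : R * R -> R) by exact: measurable_snd.
have mS : measurable_fun [set: R * R] (fun z : R * R => 1 + z.1 + z.2).
  by apply: measurable_funD => //; exact: measurable_funD.
have mL c : measurable_fun [set: R * R]
    (fun z : R * R => c + alpha * z.1 + beta * z.2).
  apply: measurable_funD; last exact: measurable_funM.
  by apply: measurable_funD => //; exact: measurable_funM.
apply: measurable_fun_pair; apply: measurable_funM.
- exact: measurable_funM.
- exact: measurable_fun_div.
- exact: measurable_funM.
- exact: measurable_fun_div.
Qed.

(** The Moebius map sends 0 to 0 and [s / beta] to [s / alpha]. Its derivative has numerator [(beta
    + s) * (den y - (alpha - beta) * y)], which is the constant [(beta + s) * (alpha + s)]. *)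
Lemma ge0_integral_moebius alpha beta s (h : R -> \bar R) :
  0 < alpha -> 0 < beta -> 0 < s ->
  measurable_fun [set: R] h -> (forall x, 0 <= h x)%E ->
  let den y := alpha + s + (alpha - beta) * y in
  (\int[lebesgue_measure]_(u in `]0%R, (s / alpha)%R[) h u =
   \int[lebesgue_measure]_(y in `]0%R, (s / beta)%R[)
     (h (y * (beta + s) / den y)%R *
      ((beta + s) * (alpha + s) / (den y * den y))%:E))%E.
Proof.
move=> a0 b0 s0 mh h0 den.
pose F y := y * (beta + s) / den y.
pose f y := (beta + s) * (alpha + s) / (den y * den y).
(* Here [den y = alpha + alpha * y + (s - beta * y)], with the last two terms nonnegative on the
   interval. *)
have den0 y : y \in `[0, s / beta] -> 0 < den y.
  rewrite in_itv/= ler_pdivlMr// => /andP[y0 ys]; rewrite /den.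
  have : 0 <= alpha * y by rewrite mulr_ge0 // ltW.
  lra.
have mden : measurable_fun [set: R] den.
  by apply: measurable_funD => //; exact: measurable_funM.
have dden y : is_derive y (1 : R) den (alpha - beta).
  by apply: is_derive_eq; rewrite add0r mul1r; exact: mulr1.
have F0 : F 0 = 0 by rewrite /F !mul0r.
have Fs : F (s / beta) = s / alpha.
  rewrite /F /den; field; rewrite (lt0r_neq0 a0) (lt0r_neq0 b0)/=.
  rewrite (_ : _ + _ = alpha * (s + beta)); last by ring.
  by apply: lt0r_neq0; rewrite mulr_gt0// addr_gt0.
rewrite -[in LHS]F0 -Fs.
apply: (@ge0_integral_substitution_oo _ F f) => //.
- by rewrite divr_gt0.
- move=> y /den0 dy0; have dn : den y != 0 by exact: lt0r_neq0.
  have dV := is_deriveV dn (dden y).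
  apply: is_derive_eq.
  have scaleE (p q : R) : p *: (q : R^o) = p * q by [].
  rewrite !scaleE /f; move: dn; rewrite /den => dn.
  by field.
- move=> y /den0 dy0.
  have cden : {for y, continuous den}.
    exact/differentiable_continuous/derivable1_diffP/ex_derive.
  apply: cvgM; first exact: cvg_cst.
  by apply: cvgV; [rewrite mulf_neq0// lt0r_neq0|exact: cvgM].
- move=> y /den0 dy0; rewrite /f divr_gt0 ?mulr_gt0//; lra.
- by apply: measurable_fun_div => //; exact: measurable_funM.
- by apply: measurable_fun_div => //; exact: measurable_funM.
Qed.

(* The identity of [integral_H_II] on the level line [alpha x + beta y = s]. *)
Lemma integral_H_II_slice alpha beta lam a b s (h : R * R -> R) :
  0 < alpha -> 0 < beta ->
  measurable_fun [set: R * R] h -> (forall z, 0 <= h z) ->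
  let C := expR (lam * (ln beta - ln alpha)) in
  (\int[lebesgue_measure]_y (alpha^-1%:E *
     (h (H_II alpha beta ((s - beta * y) / alpha) y) *
      (kummer_dens lam a b alpha 1 ((s - beta * y) / alpha) *
       kummer_dens (- lam) a b beta 1 y))%:E) =
   \int[lebesgue_measure]_u (beta^-1%:E *
     (C * (h (u, ((s - alpha * u) / beta)%R) *
      (kummer_dens (- lam) a b alpha 1 u *
       kummer_dens lam a b beta 1 ((s - alpha * u) / beta))))%:E))%E.
Proof.
move=> a0 b0 mh h0 C.
pose N u := (beta^-1 * (C * (h (u, ((s - alpha * u) / beta)) *
      (kummer_dens (- lam) a b alpha 1 u *
       kummer_dens lam a b beta 1 ((s - alpha * u) / beta))))).
(* Outside []0, s / q[] one of the two coordinates is nonpositive, so its density vanishes: both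
   integrands live on bounded open intervals, empty when [s <= 0]. *)
have sub0 p q x : 0 < p -> 0 < q -> ~~ (0 < x < s / q) ->
    x <= 0 \/ (s - q * x) / p <= 0.
  move=> p0 q0; rewrite negb_and -!leNgt => /orP[|sx]; [by left|right].
  rewrite pmulr_lle0 ?invr_gt0// subr_le0 mulrC.
  by rewrite -ler_pdivrMr.
have [s0|s0] := leP s 0.
  have noitv q x : 0 < q -> ~~ (0 < x < s / q).
    move=> q0; rewrite negb_and -!leNgt; have [//|x0] := leP x 0.
    by rewrite (le_trans _ (ltW x0))// pmulr_lle0 ?invr_gt0.
  rewrite !integral0_eq// => x _.
    by case: (sub0 beta alpha x b0 a0 (noitv _ _ a0)) => xs;
      rewrite (kummer_dens_eq0 _ _ _ _ xs) ?mul0r ?mulr0 ?mule0.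
  by case: (sub0 alpha beta x a0 b0 (noitv _ _ b0)) => xs;
      rewrite (kummer_dens_eq0 _ _ _ _ xs) ?mul0r ?mulr0 ?mule0.
transitivity (\int[lebesgue_measure]_(u in `]0%R, (s / alpha)%R[) (N u)%:E)%E; last first.
  rewrite integral_mkcond; apply: eq_integral => x _; rewrite patchE -EFinM.
  case: ifPn => //; rewrite notin_setE/= in_itv/= => /negP/(sub0 beta alpha x b0 a0).
  by move=> [xs|xs]; rewrite (kummer_dens_eq0 _ _ _ _ xs) ?mul0r ?mulr0.
rewrite (@ge0_integral_moebius alpha beta)//; last 2 first.
- apply/measurable_EFinP; apply: measurable_funM => //; apply: measurable_funM => //.
  have mv : measurable_fun [set: R] (fun u : R => (s - alpha * u) / beta).
    by apply: measurable_funM => //; exact: measurable_funB.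
  apply: measurable_funM; last apply: measurable_funM.
  + by apply: (measurableT_comp mh); exact: measurable_fun_pair.
  + exact: measurable_kummer_dens.
  + exact: (measurableT_comp (measurable_kummer_dens _ _ _ _) mv).
- move=> x; rewrite lee_fin !mulr_ge0 ?invr_ge0 ?expR_ge0 ?kummer_dens_ge0//.
  exact: ltW.
rewrite [RHS]integral_mkcond; apply: eq_integral => y _; rewrite patchE -EFinM.
case: ifPn; last first.
  rewrite notin_setE/= in_itv/= => /negP/(sub0 alpha beta y a0 b0).
  by move=> [xs|xs]; rewrite (kummer_dens_eq0 _ _ _ _ xs) ?mul0r ?mulr0.
rewrite inE/= in_itv/= => /andP[y0 ys]; rewrite -EFinM; congr EFin.
set x := (s - beta * y) / alpha.
have x0 : 0 < x by rewrite divr_gt0// subr_gt0 mulrC -ltr_pdivlMr.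
have sE : s = alpha * x + beta * y by rewrite /x; field; exact: lt0r_neq0.
have ax0 : 0 < alpha * x by exact: mulr_gt0.
have by0 : 0 < beta * y by exact: mulr_gt0.
have S0 : 1 + x + y != 0 by apply: lt0r_neq0; lra.
have an : alpha != 0 by exact: lt0r_neq0.
have bn : beta != 0 by exact: lt0r_neq0.
have denE : alpha + s + (alpha - beta) * y = alpha * (1 + x + y).
  by rewrite sE; ring.
have uE : y * (beta + s) / (alpha * (1 + x + y)) = (H_II alpha beta x y).1.
  by rewrite /H_II/= sE; field; rewrite S0.
rewrite denE uE /N.
(* By conservation, the point of the level line with first coordinate [u] is the image of
   [(x, y)]. *)
have -> : (s - alpha * (H_II alpha beta x y).1) / beta = (H_II alpha beta x y).2.
  by rewrite sE -(H_II_conserved a0 b0 x0 y0); field.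
rewrite -surjective_pairing.
have := kummer_dens_H_II lam a b a0 b0 x0 y0; cbv zeta.
rewrite -/C expr2 -!addrA -sE.
set A := kummer_dens lam a b alpha 1 x * _ => HA.
rewrite mulrCA (mulrC _ A) HA.
by ring.
Qed.

(** Shearing both sides to the common outer variable [s] leaves inner integrals that agree slice by
    slice. *)
Lemma integral_H_II alpha beta lam a b (h : R * R -> R) :
  0 < alpha -> 0 < beta ->
  measurable_fun [set: R * R] h -> (forall z, 0 <= h z) ->
  let C := expR (lam * (ln beta - ln alpha)) in
  (\int[lebesgue_measure]_x \int[lebesgue_measure]_y
     (h (H_II alpha beta x y) *
      (kummer_dens lam a b alpha 1 x * kummer_dens (- lam) a b beta 1 y))%:E =
   \int[lebesgue_measure]_u \int[lebesgue_measure]_v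
     (C * (h (u, v) *
      (kummer_dens (- lam) a b alpha 1 u * kummer_dens lam a b beta 1 v)))%:E)%E.
Proof.
move=> a0 b0 mh h0 C; pose L := measurableTypeR R.
have mk1 lam' p : measurable_fun [set: L * L]
    (fun z : L * L => kummer_dens lam' a b p 1 z.1).
  exact: (measurableT_comp (measurable_kummer_dens _ _ _ _) measurable_fst).
have mk2 lam' p : measurable_fun [set: L * L]
    (fun z : L * L => kummer_dens lam' a b p 1 z.2).
  exact: (measurableT_comp (measurable_kummer_dens _ _ _ _) measurable_snd).
have mk : measurable_fun [set: L * L] (fun z : L * L =>
    (h (H_II alpha beta z.1 z.2) * (kummer_dens lam a b alpha 1 z.1 *
      kummer_dens (- lam) a b beta 1 z.2))%:E).
  apply/measurable_EFinP; apply: measurable_funM; last exact: measurable_funM.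
  exact: (measurableT_comp mh (measurable_H_II _ _)).
have mK : measurable_fun [set: L * L] (fun z : L * L =>
    (C * (h z * (kummer_dens (- lam) a b alpha 1 z.1 *
      kummer_dens lam a b beta 1 z.2)))%:E).
  apply/measurable_EFinP; apply: measurable_funM => //.
  by apply: measurable_funM => //; exact: measurable_funM.
have mK' : measurable_fun [set: L * L] (fun z : L * L =>
    (C * (h (z.2, z.1) * (kummer_dens (- lam) a b alpha 1 z.2 *
      kummer_dens lam a b beta 1 z.1)))%:E).
  apply/measurable_EFinP; apply: measurable_funM => //.
  apply: measurable_funM => //; last exact: measurable_funM.
  apply: (measurableT_comp mh).
  by apply: measurable_fun_pair; [exact: measurable_snd|exact: measurable_fst].
have K0 (u v : R) : (0 <= (C * (h (u, v) * (kummer_dens (- lam) a b alpha 1 u *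
      kummer_dens lam a b beta 1 v)))%:E)%E.
  by rewrite lee_fin !mulr_ge0 ?expR_ge0 ?kummer_dens_ge0.
apply: (etrans (integral_shear beta a0 mk _)).
  by move=> z; rewrite lee_fin !mulr_ge0 ?kummer_dens_ge0.
(* The order is exchanged first so that the shear eliminates [v] and keeps [u] as inner variable. *)
apply/esym; apply: (etrans (fubini_tonelli _ mK _)); first by move=> [u v]; exact: K0.
apply: (etrans (integral_shear alpha b0 mK' _)); first by move=> [v u]; exact: K0.
by apply: eq_integral => s _; rewrite integral_H_II_slice.
Qed.

End kummer.

(** * Independence and laws of the image pair *)

Theorem theorem1p1 (d : measure_display) (T : measurableType d) (R : realType)
  (P : probability T R) (X Y : T -> R)
  (alpha beta lam a b : R)
  (halpha : 0 < alpha) (hbeta : 0 < beta) (ha : 0 < a) (hb : 0 < b)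
  (hlam1 : - b < lam / 2) (hlam2 : lam / 2 < b)
  (mX : measurable_fun setT X) (mY : measurable_fun setT Y)
  (hX : has_kummer_law P X lam a b alpha 1)
  (hY : has_kummer_law P Y (- lam) a b beta 1)
  (hXY : indep_rv P X Y) :
  let U := fun t => (H_II alpha beta (X t) (Y t)).1 in
  let V := fun t => (H_II alpha beta (X t) (Y t)).2 in
  [/\ indep_rv P U V,
      has_kummer_law P U (- lam) a b alpha 1 &
      has_kummer_law P V lam a b beta 1].
Proof.
move=> U V; case: hX => c [c0 hX]; case: hY => c' [c'0 hY].
pose C := expR (lam * (ln beta - ln alpha)).
pose K := c * c' * C.
have K0 : 0 < K by rewrite !mulr_gt0 ?expR_gt0.
pose F := kummer_dens (- lam) a b alpha 1 : R -> R.
pose G := kummer_dens lam a b beta 1 : R -> R.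
pose IF A := (\int[lebesgue_measure]_(x in A) (F x)%:E)%E.
pose IG A := (\int[lebesgue_measure]_(x in A) (G x)%:E)%E.
have F0 x : 0 <= F x by exact: kummer_dens_ge0.
have G0 x : 0 <= G x by exact: kummer_dens_ge0.
have mF : measurable_fun [set: R] F by exact: measurable_kummer_dens.
have mG : measurable_fun [set: R] G by exact: measurable_kummer_dens.
have IF0 A : (0 <= IF A)%E by apply: integral_ge0 => x _; rewrite lee_fin.
have IG0 A : (0 <= IG A)%E by apply: integral_ge0 => x _; rewrite lee_fin.
have IFE A : measurable A ->
    IF A = (\int[lebesgue_measure]_x (\1_A x * F x)%:E)%E.
  move=> mA; rewrite /IF integral_mkcond; apply: eq_integral => x _.
  by rewrite epatch_indic -EFinM mulrC.
have IGE A : measurable A ->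
    IG A = (\int[lebesgue_measure]_x (\1_A x * G x)%:E)%E.
  move=> mA; rewrite /IG integral_mkcond; apply: eq_integral => x _.
  by rewrite epatch_indic -EFinM mulrC.
(* The joint law of [(U, V)] on rectangles: [integral_H_II] is applied to the indicator of [A * B],
   and the double integral then splits into a product. *)
have law A B : measurable A -> measurable B ->
    (P (U @^-1` A `&` V @^-1` B) = K%:E * (IF A * IG B))%E.
  move=> mA mB; pose H (z : R * R) := H_II alpha beta z.1 z.2.
  have mAB : measurable (A `*` B) by exact: measurableX.
  have mM : measurable (H @^-1` (A `*` B)).
    by rewrite -[X in measurable X]setTI; exact: measurable_H_II.
  rewrite -[LHS]/(P ((fun t => (X t, Y t)) @^-1` (H @^-1` (A `*` B)))).
  rewrite (indep_rv_joint_law mX mY hXY (measurable_kummer_dens _ _ _ _)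
    (measurable_kummer_dens _ _ _ _) (@kummer_dens_ge0 _ _ _ _ _)
    (@kummer_dens_ge0 _ _ _ _ _) (ltW c0) (ltW c'0) hX hY mM).
  have mh : measurable_fun [set: R * R] (\1_(A `*` B) : R * R -> R).
    exact: measurable_indic.
  rewrite -[X in (_ * X)%E]/(\int[lebesgue_measure]_x \int[lebesgue_measure]_y
     (\1_(A `*` B) (H_II alpha beta x y) *
      (kummer_dens lam a b alpha 1 x * kummer_dens (- lam) a b beta 1 y))%:E)%E.
  rewrite integral_H_II// -/C.
  transitivity ((c * c')%:E * \int[lebesgue_measure]_u
      ((C * (\1_A u * F u))%:E * IG B))%E.
    congr (_ * _)%E; apply: eq_integral => u _; rewrite IGE// -ge0_integralZl//.
    - apply: eq_integral => v _; rewrite -EFinM; congr EFin.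
      rewrite -/(F u) -/(G v).
      have -> : \1_(A `*` B) (u, v) = \1_A u * \1_B v :> R.
        by rewrite !indicE in_setX/=; case: (u \in A); case: (v \in B);
          rewrite ?mulr1 ?mulr0.
      by ring.
    - by apply/measurable_EFinP; exact: measurable_funM.
    - by move=> v _; rewrite lee_fin mulr_ge0.
    - by rewrite lee_fin !mulr_ge0 ?expR_ge0.
  rewrite ge0_integralZr//; last 2 first.
  - apply/measurable_EFinP; apply: measurable_funM => //.
    exact: measurable_funM.
  - by move=> u _; rewrite lee_fin !mulr_ge0 ?expR_ge0.
  under eq_integral do rewrite EFinM.
  rewrite ge0_integralZl//; last 3 first.
  - by apply/measurable_EFinP; exact: measurable_funM.
  - by move=> u _; rewrite lee_fin mulr_ge0.
  - by rewrite lee_fin expR_ge0.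
  by rewrite -IFE// !muleA -EFinM.
(* No normalising constant is computed: a finite nonzero product of two
   nonnegative extended reals has finite nonzero factors. *)
have [f [g [f0 g0 IFT IGT KfgE]]] : exists f g : R,
    [/\ 0 < f, 0 < g, IF setT = f%:E, IG setT = g%:E & K * (f * g) = 1].
  have := law setT setT measurableT measurableT.
  rewrite !preimage_setT setIT probability_setT.
  (* An infinite factor makes the product infinite, or 0 against a zero factor by the convention for
     0 times infinity; neither equals 1. *)
  move: (IF0 setT) (IG0 setT); case: (IF setT) => [f| |] //; last first.
    case: (IG setT) => [g| |] //.
      move=> _; rewrite le_eqVlt => /predU1P[[<-]|]; first by rewrite !mule0 => -[] /eqP;
        rewrite oner_eq0.
      by rewrite lte_fin => g0; rewrite mulyr gtr0_sg// mul1e mulry gtr0_sg// mul1e.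
    by move=> _ _; rewrite mulyy mulry gtr0_sg// mul1e.
  case: (IG setT) => [g| |] //; last first.
    rewrite le_eqVlt => /predU1P[[<-]|]; first by rewrite mul0e mule0 => _ -[] /eqP;
      rewrite oner_eq0.
    by rewrite lte_fin => f0 _; rewrite mulry gtr0_sg// mul1e mulry gtr0_sg// mul1e.
  rewrite !lee_fin -!EFinM => f0 g0 [E].
  have fg0 : f * g != 0.
    by apply/eqP => fg; move: E; rewrite fg mulr0 => /eqP; rewrite oner_eq0.
  move: fg0; rewrite mulf_eq0 negb_or => /andP[fn gn].
  by exists f, g; split => //; rewrite lt0r ?fn ?gn.
(* The marginals are obtained by letting the other set be the whole line. *)
have lawU A : measurable A -> (P (U @^-1` A) = (K * g)%:E * IF A)%E.
  move=> mA; have := law A setT mA measurableT.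
  by rewrite preimage_setT setIT IGT muleC -muleA -EFinM muleC (mulrC g).
have lawV B : measurable B -> (P (V @^-1` B) = (K * f)%:E * IG B)%E.
  move=> mB; have := law setT B measurableT mB.
  by rewrite preimage_setT setTI IFT muleA -EFinM.
split.
(* The constants match because [K * (f * g) = 1] gives [K = (K * g) * (K * f)]. *)
- move=> A B mA mB; rewrite law// lawU// lawV// muleACA -EFinM; congr (_%:E * _)%E.
  by rewrite -[LHS]mulr1 -KfgE; ring.
- by exists (K * g); split => //; rewrite mulr_gt0.
- by exists (K * f); split => //; rewrite mulr_gt0.
Qed.
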